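(* Let $R$ be a commutative ring with identity, $M$ a unital $R$-module and $N$ a proper submodule of $M$. Then the following statements are equivalent. (1) $N$ is a semi $n$-submodule of $M$. (2) Whenever $r\in R$, $m\in M$ and $k\in\mathbb{N}$ satisfy $r^{k}m\in N$, $r\notin\sqrt{0}$ and $Ann_{R}(m)=0$, then $rm\in N$. (3) For all $m\in M$ with $Ann_{R}(m)=0$, one has $\sqrt{(N:_{R}m)}=\sqrt{0}\cup(N:_{R}m)$.
   Context: $\mathbb{N}$ denotes the positive integers. $\sqrt{0}$ is the nilradical of $R$; $Ann_R(m)=\{r\in R: rm=0\}$; $(N:_R m)=\{r\in R: rm\in N\}$; $\sqrt{I}$ denotes the radical of an ideal $I$. A proper submodule $N$ of $M$ is called a semi $n$-submodule if whenever $r\in R$, $m\in M$ with $r^{2}m\in N$, $r\notin\sqrt{0}$ and $Ann_R(m)=0$, then $rm\in N$. *)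

(* Defs.v *)
From mathcomp Require Import all_boot all_algebra.
From mathcomp Require Import boolp classical_sets.

Set Implicit Arguments.
Unset Strict Implicit.
Unset Printing Implicit Defensive.

Import GRing.Theory.

Local Open Scope ring_scope.
Local Open Scope classical_set_scope.

Definition radical (R : comPzRingType) (I : set R) : set R :=
  [set r | exists2 k : nat, (0 < k)%N & I (r ^+ k)].

Definition nilradical (R : comPzRingType) : set R := radical [set 0].
Arguments nilradical R : clear implicits.

Definition annihilator (R : comPzRingType) (M : lmodType R) (m : M) : set R :=
  [set r | r *: m = 0].

(** The residual ideal [(N :_R m)]. *)
Definition colon (R : comPzRingType) (M : lmodType R) (N : set M) (m : M) :
    set R :=
  [set r | N (r *: m)].

Definition proper_submodule (R : comPzRingType) (M : lmodType R) (N : set M) :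
    Prop :=
  GRing.submod_closed [in N] /\ N <> [set: M].

Definition semi_n_submodule (R : comPzRingType) (M : lmodType R) (N : set M) :
    Prop :=
  proper_submodule N /\
  forall (r : R) (m : M),
    N (r ^+ 2 *: m) -> ~ nilradical R r -> annihilator m = [set 0] ->
    N (r *: m).

(* Main.v *)
Require Import Defs.
From mathcomp Require Import all_boot all_algebra.
From mathcomp Require Import boolp classical_sets.

Local Open Scope ring_scope.
Local Open Scope classical_set_scope.

(** The content is the passage from squares to all exponents, [semi_n_submodule_exp]: with [m]
    fixed, the exponent of [r] is lowered one unit at a time, applying the square condition to
    powers of [r], which stay non-nilpotent by [nilradicalX]. The radical equality only rewords
    this: [r] lies in the radical of [colon N m] when some positive power of [r] sends [m] into [N],
    and exponent 2 recovers the definition. *)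

Lemma proper_submodule0 (R : comPzRingType) (M : lmodType R) (N : set M) :
  proper_submodule N -> N 0.
Proof. by move=> [[N0 _] _]; apply: set_mem. Qed.

Lemma proper_submoduleZ (R : comPzRingType) (M : lmodType R) (N : set M)
    (a : R) (m : M) :
  proper_submodule N -> N m -> N (a *: m).
Proof.
move=> [[N0 NZD] _] /mem_set Nm; apply: set_mem.
by have := NZD a m 0 Nm N0; rewrite GRing.addr0.
Qed.

Lemma nilradicalX (R : comPzRingType) (r : R) (k : nat) :
  (0 < k)%N -> nilradical R (r ^+ k) -> nilradical R r.
Proof.
move=> k_gt0 [j j_gt0 rkj0]; exists (k * j)%N; first by rewrite muln_gt0 k_gt0.
by rewrite GRing.exprM.
Qed.

(* The defining property is applied to powers of [r] and the fixed [m]: applying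
   it to [r] and multiples of [m] would need those to have zero annihilator. *)
Lemma semi_n_submodule_exp (R : comPzRingType) (M : lmodType R) (N : set M)
    (r : R) (m : M) (k : nat) :
  semi_n_submodule N -> (0 < k)%N -> N (r ^+ k *: m) -> ~ nilradical R r ->
  annihilator m = [set 0] -> N (r *: m).
Proof.
move=> [hN semiN] + + r_nnil m_ann0; case: k => // k _.
elim: k => [|k IHk Nrm]; first by rewrite GRing.expr1.
apply: IHk; apply: semiN => //; last by move/nilradicalX; auto.
(* Since 2(k+1) = k + (k+2), the square of [r ^+ k.+1] is a multiple of [r ^+ k.+2], which already
   sends [m] into [N]. *)
have -> : (r ^+ k.+1) ^+ 2 = r ^+ k * r ^+ k.+2.
  by rewrite -GRing.exprM -GRing.exprD muln2 -addnn addSnnS.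
by rewrite -GRing.scalerA; apply: proper_submoduleZ.
Qed.

Theorem theorem1 (R : comPzRingType) (M : lmodType R) (N : set M)
    (hN : proper_submodule N) :
  [<-> semi_n_submodule N;
       forall (r : R) (m : M) (k : nat), (0 < k)%N ->
         N (r ^+ k *: m) -> ~ nilradical R r -> annihilator m = [set 0] ->
         N (r *: m);
       forall m : M, annihilator m = [set 0] ->
         radical (colon N m) = nilradical R `|` colon N m].
Proof.
tfae.
- by move=> semiN r m k; apply: semi_n_submodule_exp.
- move=> expN m m_ann0; apply/seteqP; split=> r.
    move=> [k k_gt0 Nrkm]; have [|r_nnil] := pselect (nilradical R r); first by left.
    by right; apply: (expN r m k).
  (* Reverse inclusion: a vanishing power of [r] sends [m] to 0, which lies in [N]; an element of
     [colon N m] is its own first power. *)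
  move=> [[k k_gt0 rk0]|Nrm]; last by exists 1%N; rewrite ?GRing.expr1.
  exists k => //; rewrite /colon /= rk0 GRing.scale0r.
  exact: proper_submodule0.
- move=> radN; split=> // r m Nr2m r_nnil m_ann0.
  have : radical (colon N m) r by exists 2.
  by rewrite radN // => -[].
Qed.
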